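(* If $\boldsymbol{\mu}$ is a quantum universal semi-density matrix, then $\operatorname{tr}(\boldsymbol{\mu}(N))<1$ for all but finitely many $N\in\mathbb{N}^+$.
   Context: For $N\in\mathbb{N}^+$, $\mathrm{Her}(N)$ is the set of $N\times N$ Hermitian matrices and $\mathrm{Her}_Q(N)$ those with entries in $\{a+ib:a,b\in\mathbb{Q}\}$; $A\leqslant B$ means $B-A$ is positive semi-definite. A lower semicomputable semi-density matrix is a map $\sigma:\mathbb{N}^+\to\bigcup_{N\ge1}\mathrm{Her}(N)$ such that (i) for each $N$, $\sigma(N)\in\mathrm{Her}(N)$, $0\leqslant\sigma(N)$ and $\operatorname{tr}\sigma(N)\le 1$; (ii) there is a total recursive $f:\mathbb{N}^+\times\mathbb{N}\to\bigcup_{N\ge1}\mathrm{Her}_Q(N)$ with, for each $N$, $f(N,k)\in\mathrm{Her}_Q(N)$, $f(N,k)\leqslant f(N,k+1)$ for all $k$, and $\lim_{k\to\infty}f(N,k)=\sigma(N)$. A quantum universal semi-density matrix is a lower semicomputable semi-density matrix $\boldsymbol{\mu}$ such that for every lower semicomputable semi-density matrix $\sigma$ there is $c>0$ with $c\,\sigma(N)\leqslant\boldsymbol{\mu}(N)$ for all $N\in\mathbb{N}^+$. *)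

(* Defs.v *)
From HB Require Import structures.
From mathcomp Require Import all_boot all_order all_algebra.
From mathcomp Require Import complex.
From mathcomp Require Import all_classical all_reals all_analysis.
Set Implicit Arguments. Unset Strict Implicit. Unset Printing Implicit Defensive.
Import Order.TTheory GRing.Theory Num.Theory.
Import numFieldNormedType.Exports.

(* A model of computation: register (counter / Minsky) machines.       *)
(* Registers are indexed by nat (a program only uses finitely many).   *)
Inductive instr : Type :=
| Inc of nat
| DecJz of nat & nat.

Definition rm_state : Type := (nat * (nat -> nat))%type.

Definition rm_upd (g : nat -> nat) (r v : nat) : nat -> nat :=
  fun i => if i == r then v else g i.

Definition rm_step (p : seq instr) (s : rm_state) : rm_state :=
  let: (pc, g) := s in
  if pc < size p then
    match nth (Inc 0) p pc with
    | Inc r => (pc.+1, rm_upd g r (g r).+1)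
    | DecJz r l => if g r == 0 then (l, g) else (pc.+1, rm_upd g r (g r).-1)
    end
  else s.

Definition rm_run (p : seq instr) (k : nat) (s : rm_state) : rm_state :=
  iter k (rm_step p) s.

Definition rm_init (n : nat) : rm_state := (0, fun i => if i == 0 then n else 0).

Definition rm_computes (p : seq instr) (h : nat -> nat) : Prop :=
  forall n, exists k, let s := rm_run p k (rm_init n) in
    size p <= s.1 /\ s.2 0 = h n.

Definition total_recursive (h : nat -> nat) : Prop :=
  exists p : seq instr, rm_computes p h.

Definition npair (a b : nat) : nat := (2 ^ a * b.*2.+1).-1.
Definition nfst (c : nat) : nat := logn 2 c.+1.
Definition nsnd (c : nat) : nat := (c.+1 %/ 2 ^ nfst c)./2.

Fixpoint seq_comp (c i : nat) : nat :=
  match i with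
  | 0 => nfst c
  | i'.+1 => seq_comp (nsnd c) i'
  end.

(* surjection nat -> int : 0,1,2,3,4,... |-> 0,-1,1,-2,2,... *)
Definition int_of_nat (z : nat) : int :=
  if odd z then (- (Posz (z.+1)./2))%R else Posz z./2.

Definition rat_of_nat (m : nat) : rat :=
  ((int_of_nat (nfst m))%:~R / (nsnd m).+1%:R)%R.

Local Open Scope ring_scope.
Local Open Scope complex_scope.

Definition decode_mx (R : realType) (N c : nat) : 'M[R[i]]_N :=
  \matrix_(i < N, j < N)
    Complex (ratr (rat_of_nat (seq_comp c (2 * (i * N + j))%N)))
            (ratr (rat_of_nat (seq_comp c (2 * (i * N + j)).+1))).

Definition hermitian (R : realType) (N : nat) (A : 'M[R[i]]_N) : Prop :=
  (map_mx conjc A)^T = A.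

Definition psd (R : realType) (N : nat) (A : 'M[R[i]]_N) : Prop :=
  hermitian A /\
  forall v : 'cV[R[i]]_N, 0 <= ((map_mx conjc v)^T *m A *m v) 0 0.

Definition loewner_le (R : realType) (N : nat) (A B : 'M[R[i]]_N) : Prop :=
  psd (B - A).

Definition semi_density (R : realType) (N : nat) (A : 'M[R[i]]_N) : Prop :=
  hermitian A /\ psd A /\ \tr A <= 1.

Local Open Scope classical_set_scope.

(* lower semicomputable semi-density matrix; sigma N is only relevant
   for N in N^+ = {N | 0 < N}. *)
Definition lsc_semi_density (R : realType)
    (sigma : forall N : nat, 'M[R[i]]_N) : Prop :=
  (forall N : nat, (0 < N)%N -> semi_density (sigma N)) /\
  exists h : nat -> nat, total_recursive h /\
    forall N : nat, (0 < N)%N ->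
      (forall k : nat, hermitian (decode_mx R N (h (npair N k)))) /\
      (forall k : nat, loewner_le (decode_mx R N (h (npair N k)))
                                  (decode_mx R N (h (npair N k.+1)))) /\
      (forall i j : 'I_N,
         ((fun k => complex.Re (decode_mx R N (h (npair N k)) i j)) @ \oo
            --> complex.Re (sigma N i j)) /\
         ((fun k => complex.Im (decode_mx R N (h (npair N k)) i j)) @ \oo
            --> complex.Im (sigma N i j))).

Definition quantum_universal (R : realType)
    (mu : forall N : nat, 'M[R[i]]_N) : Prop :=
  lsc_semi_density mu /\
  forall sigma : forall N : nat, 'M[R[i]]_N, lsc_semi_density sigma ->
    exists c : R, 0 < c /\
      forall N : nat, (0 < N)%N -> loewner_le (c%:C *: sigma N) (mu N).

(* Main.v *)
Require Import Defs.
From HB Require Import structures.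
From mathcomp Require Import all_boot all_order all_algebra.
From mathcomp Require Import complex.
From mathcomp Require Import all_classical all_reals all_analysis.
From mathcomp Require Import zify lra.
Import Order.TTheory GRing.Theory Num.Theory.
Import numFieldNormedType.Exports.

(** Let f(N, w) be the computable increasing approximations of mu(N).  For each
    N, search for a w such that, at stage w, the positive parts of the diagonal
    entries of f(N, w) other than the one at i = w mod N already add up to more
    than 1 - 2/N.  Let sigma(N) be the projection E_ii for the first w found, and
    0 if there is none; sigma is a lower semicomputable semi-density matrix.

    When the search succeeds, mu(N)_ii < 2/N, because tr mu(N) <= 1 and the
    diagonal of mu(N) dominates both 0 and the diagonal of f(N, w).  If
    tr mu(N) = 1, then some mu(N)_ii is at most 1/N, and the search succeeds for
    all large w congruent to i mod N.  Hence, if c sigma <= mu and tr mu(N) = 1,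
    then c <= mu(N)_ii < 2/N, which bounds N.

    The search is a bounded iteration around calls to f, so it suffices to close
    register-machine computability under composition and bounded iteration. *)

(** * Composing register machines *)

Local Open Scope nat_scope.

Definition shift_instr (o : nat) (i : instr) : instr :=
  match i with Inc r => Inc r | DecJz r l => DecJz r (o + l) end.

Definition jumps_within (n : nat) (i : instr) : bool :=
  match i with Inc _ => true | DecJz _ l => l <= n end.

(** Ending exactly at [size p], with no jump target past it, is what lets instructions appended
    after [p] take over. *)
Definition runs (p : seq instr) (g g' : nat -> nat) : Prop :=
  all (jumps_within (size p)) p /\ exists k, rm_run p k (0, g) = (size p, g').

Lemma rm_runD p k1 k2 s : rm_run p (k1 + k2) s = rm_run p k2 (rm_run p k1 s).
Proof. by rewrite /rm_run addnC iterD. Qed.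

Lemma rm_runS p k s : rm_run p k.+1 s = rm_run p k (rm_step p s).
Proof. by rewrite /rm_run iterSr. Qed.

Lemma rm_run_halted p k pc g : size p <= pc -> rm_run p k (pc, g) = (pc, g).
Proof. by move=> h; elim: k => //= k ->; rewrite /rm_step ltnNge h. Qed.

Lemma shift_instr0 p : map (shift_instr 0) p = p.
Proof. by rewrite -[RHS]map_id; apply: eq_map => -[]. Qed.

(** Each step of [p] is matched by one step of the larger program. The number of steps may drop,
    because idle steps of [p] after its end must not be carried on into [post]. *)
Lemma rm_run_embed pre post p k pc g g' :
  all (jumps_within (size p)) p -> pc <= size p ->
  rm_run p k (pc, g) = (size p, g') ->
  exists k', rm_run (pre ++ map (shift_instr (size pre)) p ++ post) k'
                    (size pre + pc, g) = (size pre + size p, g').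
Proof.
move=> wfp; elim: k pc g => [|k IH] pc g lepc.
  by case=> -> ->; exists 0.
case: (ltnP pc (size p)) => [ltpc|gepc]; last first.
  by rewrite rm_run_halted // => -[-> ->]; exists 0.
rewrite rm_runS => hk.
have [pc1 [g1 [e1 le1 e2]]] : exists pc1 g1,
    [/\ rm_step p (pc, g) = (pc1, g1), pc1 <= size p &
        rm_step (pre ++ map (shift_instr (size pre)) p ++ post)
          (size pre + pc, g) = (size pre + pc1, g1)].
  rewrite /rm_step ltpc !size_cat size_map ltn_add2l ltn_addr //.
  rewrite nth_cat ltnNge leq_addr /= addKn nth_cat size_map ltpc.
  rewrite (nth_map (Inc 0)) //.
  have := all_nthP (Inc 0) wfp pc ltpc.
  case: (nth _ _ _) => [r|r l] /= hl.
    by exists pc.+1, (rm_upd g r (g r).+1); rewrite addnS.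
  case: (g r == 0); first by exists l, g.
  by exists pc.+1, (rm_upd g r (g r).-1); rewrite addnS.
rewrite e1 in hk; have [k' hk'] := IH _ _ le1 hk.
by exists k'.+1; rewrite rm_runS e2.
Qed.

Definition seq_prog (p q : seq instr) := p ++ map (shift_instr (size p)) q.

(* "While register r is nonzero, decrement it and run p".  The jump back tests
   register 1, which must therefore be 0 after each run of p. *)
Definition loop_prog (r : nat) (p : seq instr) :=
  DecJz r (size p).+2 :: map (shift_instr 1) p ++ [:: DecJz 1 0].

Lemma jumps_withinW m n : m <= n -> subpred (jumps_within m) (jumps_within n).
Proof. by move=> mn [|r l] //= /leq_trans; apply. Qed.

Lemma all_jumps_shift o n p :
  all (jumps_within n) p -> all (jumps_within (o + n)) (map (shift_instr o) p).
Proof.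
by rewrite all_map; apply: sub_all => -[|r l] //=; rewrite leq_add2l.
Qed.

Lemma runs_seq p q g g1 g2 :
  runs p g g1 -> runs q g1 g2 -> runs (seq_prog p q) g g2.
Proof.
move=> [wp [k1 h1]] [wq [k2 h2]]; split.
  rewrite /seq_prog size_cat size_map all_cat all_jumps_shift //= andbT.
  by apply: sub_all wp; apply: jumps_withinW; apply: leq_addr.
have [k1'] := rm_run_embed [::] (map (shift_instr (size p)) q) p k1 0 g g1
                wp (leq0n _) h1.
rewrite shift_instr0 /= !add0n => h1'.
have [k2'] := rm_run_embed p [::] q k2 0 g1 g2 wq (leq0n _) h2.
rewrite cats0 addn0 => h2'.
exists (k1' + k2'); rewrite rm_runD h1' h2'.
by rewrite /seq_prog size_cat size_map.
Qed.

Lemma size_loop_prog r p : size (loop_prog r p) = (size p).+2.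
Proof. by rewrite /= size_cat size_map /= addn1. Qed.

Lemma all_jumps_loop r p : all (jumps_within (size p)) p ->
  all (jumps_within (size (loop_prog r p))) (loop_prog r p).
Proof.
move=> wp; rewrite size_loop_prog /= leqnn all_cat /= andbT.
apply: sub_all (all_jumps_shift 1 _ _ wp).
by apply: jumps_withinW; rewrite add1n.
Qed.

Lemma runs_loop0 r p g :
  all (jumps_within (size p)) p -> g r = 0 -> runs (loop_prog r p) g g.
Proof.
move=> wp g0; split; first exact: all_jumps_loop.
by exists 1; rewrite size_loop_prog /rm_run /= g0 eqxx.
Qed.

Lemma runs_loopS r p g g1 g2 n :
  g r = n.+1 -> runs p (rm_upd g r n) g1 -> g1 1 = 0 ->
  runs (loop_prog r p) g1 g2 -> runs (loop_prog r p) g g2.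
Proof.
move=> gr [wp [k1 h1]] z [wl [k2 h2]]; split=> //.
have [k1' h1'] := rm_run_embed [:: DecJz r (size p).+2] [:: DecJz 1 0] p k1 0
  _ _ wp (leq0n _) h1.
rewrite -[_ ++ _]/(loop_prog r p) in h1'.
have s1 : rm_step (loop_prog r p) (0, g) = (1, rm_upd g r n).
  by rewrite /rm_step size_loop_prog /= gr.
have s2 : rm_step (loop_prog r p) (1 + size p, g1) = (0, g1).
  rewrite /rm_step size_loop_prog add1n ltnS leqnn /=.
  by rewrite nth_cat size_map ltnn subnn /= z.
by exists (k1' + k2.+1).+1; rewrite rm_runS s1 rm_runD h1' rm_runS s2.
Qed.

(** [St i] is the state after [i] turns, with [r] counting down from [m]; the induction is on the
    number of turns left. *)
Lemma runs_loop r p (St : nat -> nat -> nat) m :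
  all (jumps_within (size p)) p ->
  (forall i, i <= m -> St i r = m - i) ->
  (forall i, i < m -> runs p (rm_upd (St i) r (m - i.+1)) (St i.+1)) ->
  (forall i, i <= m -> St i 1 = 0) ->
  runs (loop_prog r p) (St 0) (St m).
Proof.
move=> wp hr hp hz.
suff H j : j <= m -> runs (loop_prog r p) (St (m - j)) (St m).
  by rewrite -[in St 0](subnn m); apply: H.
elim: j => [_|j IH jm].
  by rewrite subn0; apply: runs_loop0; rewrite // hr // subnn.
have e : (m - j.+1).+1 = m - j by lia.
have := hp (m - j.+1); rewrite e => hp'.
apply: runs_loopS (IH (ltnW jm)); [|apply: hp'; lia|apply: hz; lia].
by rewrite hr; lia.
Qed.

Lemma runs_Inc r g : runs [:: Inc r] g (rm_upd g r (g r).+1).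
Proof. by split=> //; exists 1. Qed.

Lemma runs_Dec r g : runs [:: DecJz r 1] g (rm_upd g r (g r).-1).
Proof.
split=> //; exists 1; rewrite /rm_run /=; case: eqP => // g0.
congr pair; apply: funext => x; rewrite /rm_upd.
by case: eqP => // ->; rewrite g0.
Qed.

Lemma runs_nil g : runs [::] g g.
Proof. by split=> //; exists 0. Qed.

Ltac regs := rewrite /rm_upd /=; repeat (case: eqP => ?); subst;
  simpl in *; try lia.

Ltac states := intros; apply: funext => ?; regs.

Lemma runs_clear r g : g 1 = 0 -> r != 1 ->
  runs (loop_prog r [::]) g (rm_upd g r 0).
Proof.
move=> z r1.
have -> : g = rm_upd g r (g r - 0) by states.
have -> : rm_upd (rm_upd g r (g r - 0)) r 0 = rm_upd g r (g r - g r) by states.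
apply: (runs_loop _ _ (fun i => rm_upd g r (g r - i))) => //.
- by move=> i _; rewrite /rm_upd eqxx.
- move=> i _; set a := rm_upd _ _ _; have -> : a = rm_upd g r (g r - i.+1).
    by rewrite /a; states.
  exact: runs_nil.
- by move=> i _; rewrite /rm_upd eq_sym (negbTE r1).
Qed.

Lemma runs_move a b g : g 1 = 0 -> a != 1 -> b != 1 -> a != b ->
  runs (loop_prog a [:: Inc b]) g (rm_upd (rm_upd g b (g b + g a)) a 0).
Proof.
move=> z a1 b1 ab.
pose St i := rm_upd (rm_upd g b (g b + i)) a (g a - i).
have {1}-> : g = St 0 by rewrite /St; states.
have -> : rm_upd (rm_upd g b (g b + g a)) a 0 = St (g a) by rewrite /St; states.
apply: runs_loop => //.
- by move=> i _; rewrite /St /rm_upd eqxx.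
- move=> i _; set s := rm_upd _ _ _.
  have -> : St i.+1 = rm_upd s b (s b).+1 by rewrite /s /St; states.
  exact: runs_Inc.
- by move=> i _; rewrite /St /rm_upd ![1 == _]eq_sym (negbTE a1) (negbTE b1).
Qed.

(** Reading a register empties it; emptying it into two registers and moving one of them back makes
    a copy. *)
Lemma runs_move2 a b c g : g 1 = 0 -> a != 1 -> b != 1 -> c != 1 ->
  a != b -> a != c -> b != c ->
  runs (loop_prog a (seq_prog [:: Inc b] [:: Inc c])) g
    (rm_upd (rm_upd (rm_upd g b (g b + g a)) c (g c + g a)) a 0).
Proof.
move=> z a1 b1 c1 ab ac bc.
pose St i := rm_upd (rm_upd (rm_upd g b (g b + i)) c (g c + i)) a (g a - i).
have {1}-> : g = St 0 by rewrite /St; states.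
have -> : rm_upd (rm_upd (rm_upd g b (g b + g a)) c (g c + g a)) a 0 = St (g a).
  by rewrite /St; states.
apply: runs_loop => //.
- by move=> i _; rewrite /St /rm_upd eqxx.
- move=> i _; set s := rm_upd _ _ _.
  apply: runs_seq (runs_Inc _ _) _; set s' := rm_upd s _ _.
  have -> : St i.+1 = rm_upd s' c (s' c).+1 by rewrite /s' /s /St; states.
  exact: runs_Inc.
- by move=> i _; rewrite /St /rm_upd ![1 == _]eq_sym (negbTE a1) (negbTE b1)
    (negbTE c1).
Qed.

(** * Functions computable from variables held in registers *)

(* Registers below d hold variables, those from d on are scratch; register 1 is
   the zero register needed by loop_prog and never holds a variable. *)
Definition clean (d : nat) (s : nat -> nat) : Prop :=
  s 1 = 0 /\ forall x, d <= x -> s x = 0.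

Definition depends (n : nat) (f : (nat -> nat) -> nat) : Prop :=
  forall s s', (forall x, x < n -> s x = s' x) -> f s = f s'.

(** A program is asked for at every scratch base [d], so a subcomputation can be placed above
    intermediate results, which it sees as variables. All registers other than [d] are restored, and
    [1 < d] protects the zero register. *)
Definition computable (n : nat) (f : (nat -> nat) -> nat) : Prop :=
  depends n f /\ forall d, n <= d -> 1 < d ->
    exists p, forall s, clean d s -> runs p s (rm_upd s d (f s)).

Lemma clean_upd d s v : 1 < d -> clean d s -> clean d.+1 (rm_upd s d v).
Proof.
by move=> d1 [z h]; split=> [|x dx]; rewrite /rm_upd;
  case: eqP => [e|_]; subst; try lia; rewrite ?z ?h //; lia.
Qed.

Lemma cleanW d e s : d <= e -> clean d s -> clean e s.
Proof. by move=> de [z h]; split=> // x /(leq_trans de)/h. Qed.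

Lemma depends_upd n f s x v : depends n f -> n <= x -> f (rm_upd s x v) = f s.
Proof.
by move=> df nx; apply: df => y yn; rewrite /rm_upd; case: eqP => //; lia.
Qed.

Lemma computableW m n f : m <= n -> computable m f -> computable n f.
Proof.
move=> mn [df cf]; split=> [s s' h|d nd].
  by apply: df => x xm; apply: h; lia.
by apply: cf; lia.
Qed.

Lemma runs_wf p s s' : runs p s s' -> all (jumps_within (size p)) p.
Proof. by case. Qed.

Lemma computable_var n x : x < n -> x != 1 -> computable n (fun s => s x).
Proof.
move=> xn x1; split=> [s s'|d nd d1]; first exact.
exists (seq_prog (loop_prog x (seq_prog [:: Inc d] [:: Inc d.+1]))
                 (loop_prog d.+1 [:: Inc x])) => s [z hs].
apply: runs_seq; first by apply: runs_move2; rewrite //; lia.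
set s' := rm_upd _ x 0.
have -> : rm_upd s d (s x) = rm_upd (rm_upd s' x (s' x + s' d.+1)) d.+1 0.
  have := hs d (leqnn _); have := hs d.+1 (leqnSn _).
  by rewrite /s'; states.
by apply: runs_move; try lia; rewrite /s'; regs.
Qed.

Lemma computable0 n : computable n (fun=> 0).
Proof.
split=> // d _ _; exists [::] => s [_ hs].
have -> : rm_upd s d 0 = s by have := hs d (leqnn _); states.
exact: runs_nil.
Qed.

Lemma computableS n f : computable n f -> computable n (fun s => (f s).+1).
Proof.
move=> [df cf]; split=> [s s' /df-> //|d nd d1].
have [p hp] := cf d nd d1; exists (seq_prog p [:: Inc d]) => s cs.
apply: runs_seq (hp _ cs) _; set s' := rm_upd s d (f s).
have -> : rm_upd s d (f s).+1 = rm_upd s' d (s' d).+1 by rewrite /s'; states.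
exact: runs_Inc.
Qed.

Lemma computable_pred n f : computable n f -> computable n (fun s => (f s).-1).
Proof.
move=> [df cf]; split=> [s s' /df-> //|d nd d1].
have [p hp] := cf d nd d1; exists (seq_prog p [:: DecJz d 1]) => s cs.
apply: runs_seq (hp _ cs) _; set s' := rm_upd s d (f s).
have -> : rm_upd s d (f s).-1 = rm_upd s' d (s' d).-1 by rewrite /s'; states.
exact: runs_Dec.
Qed.

Lemma runs_replace d s u v : s 1 = 0 -> 1 < d ->
  runs (seq_prog (loop_prog d [::]) (loop_prog d.+1 [:: Inc d]))
    (rm_upd (rm_upd s d u) d.+1 v) (rm_upd (rm_upd s d v) d.+1 0).
Proof.
move=> z d1; apply: runs_seq.
  by apply: runs_clear; last lia; regs.
set s' := rm_upd _ d 0.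
have -> : rm_upd (rm_upd s d v) d.+1 0
        = rm_upd (rm_upd s' d (s' d + s' d.+1)) d.+1 0 by rewrite /s'; states.
by apply: runs_move; try lia; rewrite /s'; regs.
Qed.

(** The value of [e] stays in [d] as one more variable while [B] is computed into [d.+1], and is
    then overwritten by the result. *)
Lemma computable_let n e (B : nat -> (nat -> nat) -> nat) :
  computable n e -> (forall v, depends n (B v)) ->
  (forall d, n <= d -> 1 < d -> computable d.+1 (fun s => B (s d) s)) ->
  computable n (fun s => B (e s) s).
Proof.
move=> [de ce] dB cB; split=> [s s' h|d nd d1].
  by rewrite (de _ _ h); apply: dB.
have [p hp] := ce d nd d1.
have [_ /(_ d.+1 (leqnn _) (leqW d1)) [q hq]] := cB d nd d1.
exists (seq_prog (seq_prog p q)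
  (seq_prog (loop_prog d [::]) (loop_prog d.+1 [:: Inc d]))) => s cs.
apply: runs_seq; first exact: runs_seq (hp _ cs) (hq _ (clean_upd _ _ _ d1 cs)).
have -> : rm_upd s d (e s) d = e s by regs.
rewrite (depends_upd _ _ _ _ _ (dB _) nd).
have -> : rm_upd s d (B (e s) s) = rm_upd (rm_upd s d (B (e s) s)) d.+1 0.
  by have := cs.2 d.+1 (leqnSn _); states.
exact: runs_replace cs.1 d1.
Qed.

(* The step is given in a context whose last two variables hold the loop
   index and the accumulator. *)
Lemma computable_iteri n m i (B : nat -> nat -> (nat -> nat) -> nat) :
  computable n m -> computable n i -> (forall k a, depends n (B k a)) ->
  (forall d, n <= d -> 1 < d ->
     computable d.+2 (fun s => B (s d) (s d.+1) s)) ->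
  computable n (fun s => iteri (m s) (fun k a => B k a s) (i s)).
Proof.
move=> [dm cm] [di ci] dB cB; split=> [s s' h|d nd d1].
  rewrite (dm _ _ h) (di _ _ h); elim: (m s') => //= k ->.
  exact: dB.
have [pm hm] := cm d nd d1.
have [|//|pi hi] := ci d.+2 _ _; first lia.
have [_ /(_ d.+3 (leqnn _) isT) [pb hb]] := cB d.+1 (leqW nd) (leqW d1).
(* Register [d] holds the turns left, [d.+1] the loop index and [d.+2] the accumulator; [pb] leaves
   the new accumulator in [d.+3]. *)
pose body := seq_prog (seq_prog pb
  (seq_prog (loop_prog d.+2 [::]) (loop_prog d.+3 [:: Inc d.+2]))) [:: Inc d.+1].
exists (seq_prog (seq_prog (seq_prog pm pi) (loop_prog d body))
  (seq_prog (loop_prog d.+1 [::]) (loop_prog d.+2 [:: Inc d]))) => s cs.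
have zs := cs.2.
pose acc k := iteri k (fun k a => B k a s) (i s).
pose St k := rm_upd (rm_upd (rm_upd s d (m s - k)) d.+1 k) d.+2 (acc k).
have cSt u k : clean d.+3 (rm_upd (rm_upd (rm_upd s d u) d.+1 k) d.+2 (acc k)).
  by do 3 (apply: clean_upd; first lia).
have step k : runs body (rm_upd (St k) d (m s - k.+1)) (St k.+1).
  rewrite /body.
  have -> : rm_upd (St k) d (m s - k.+1)
     = rm_upd (rm_upd (rm_upd s d (m s - k.+1)) d.+1 k) d.+2 (acc k).
    by rewrite /St; states.
  set t := rm_upd _ d.+2 _.
  have tB : B (t d.+1) (t d.+2) t = acc k.+1.
    have -> : t d.+1 = k by rewrite /t; regs.
    have -> : t d.+2 = acc k by rewrite /t /rm_upd eqxx.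
    by rewrite /t !(depends_upd _ _ _ _ _ (dB _ _)) //; lia.
  apply: runs_seq; first apply: runs_seq (hb _ (cSt _ _)) _.
    rewrite -/t tB; have -> : t = rm_upd t d.+2 (acc k) by rewrite /t; states.
    by apply: runs_replace => //; rewrite /t; regs; case: cs.
  set t' := rm_upd _ d.+3 0.
  have -> : St k.+1 = rm_upd t' d.+1 (t' d.+1).+1.
    by have := zs d.+3; rewrite /St /t' /t; states.
  exact: runs_Inc.
have z1 := cs.1.
apply: runs_seq; first apply: runs_seq; first exact: runs_seq (hm _ cs)
    (hi _ (cleanW _ _ _ (leqnSn _) (clean_upd _ _ _ d1 cs))).
  rewrite (depends_upd _ _ _ _ _ di nd).
  have -> : rm_upd (rm_upd s d (m s)) d.+2 (i s) = St 0.
    by have := zs d.+1 (leqnSn _); rewrite /St /acc; states.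
  apply: (runs_loop _ _ St (m s)).
  - exact: runs_wf (step 0).
  - by move=> k _; rewrite /St; regs.
  - by move=> k _; apply: step.
  - by move=> k _; rewrite /St; regs.
apply: runs_seq.
  by apply: runs_clear; last lia; rewrite /St; regs.
set t := rm_upd _ d.+1 0.
have -> : rm_upd s d (iteri (m s) (fun k a => B k a s) (i s))
   = rm_upd (rm_upd t d (t d + t d.+2)) d.+2 0.
  have := zs d.+1 (leqnSn _); have := zs d.+2; rewrite /t /St -/(acc (m s)).
  by states.
by apply: runs_move; try lia; rewrite /t /St; regs.
Qed.

(** * Calls to arbitrary register machines *)

Lemma runs_clear_range a n : 1 < a -> exists p, forall g, g 1 = 0 ->
  runs p g (fun x => if a <= x < a + n then 0 else g x).
Proof.
move=> a1; elim: n => [|n [p hp]].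
  exists [::] => g _; rewrite [X in runs _ _ X](_ : _ = g); first exact: runs_nil.
  by apply: funext => x; case: ifP => //; lia.
exists (seq_prog p (loop_prog (a + n) [::])) => g g1.
apply: runs_seq (hp g g1) _; set g' := fun x => _.
rewrite [X in runs _ _ X](_ : _ = rm_upd g' (a + n) 0).
  by apply: runs_clear; last lia; rewrite /g'; case: ifP => //; lia.
apply: funext => x; rewrite /g' /rm_upd; case: eqP => [->|?].
  by case: ifP => //; lia.
by do 2 case: ifP => //; lia.
Qed.

(* Jumps out of the program are redirected to its end, so that whatever follows
   it is executed next. *)
Definition relocate_instr (n d : nat) (i : instr) : instr :=
  match i with
  | Inc r => Inc (d + r)
  | DecJz r l => DecJz (d + r) (minn l n)
  end.

Definition relocate (d : nat) (p : seq instr) : seq instr :=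
  map (relocate_instr (size p) d) p.

Definition overlay (d : nat) (s g : nat -> nat) : nat -> nat :=
  fun x => if x < d then s x else g (x - d).

Lemma overlay_upd d s g r v :
  overlay d s (rm_upd g r v) = rm_upd (overlay d s g) (d + r) v.
Proof.
apply: funext => x; rewrite /overlay /rm_upd.
case: ltnP => xd; do ?case: eqP => //; lia.
Qed.

(** Counters past the end all mean that the machine has halted, so capping them at [size p] commutes
    with each step. *)
Lemma rm_run_relocate p d s k pc g :
  rm_run (relocate d p) k (minn pc (size p), overlay d s g) =
  let: (pc', g') := rm_run p k (pc, g) in
  (minn pc' (size p), overlay d s g').
Proof.
elim: k => //= k ->; case: (rm_run p k (pc, g)) => {}pc {}g.
rewrite /rm_step size_map gtn_min ltnn orbF.
case: ltnP => ltpc; last by rewrite (minn_idPr ltpc).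
rewrite /relocate (nth_map (Inc 0)) //.
case: (nth _ _ _) => [r|r l] /=.
  by rewrite (minn_idPl ltpc) overlay_upd /overlay ltnNge leq_addr addKn.
rewrite {1}/overlay ltnNge leq_addr addKn /=; case: eqP => // _.
by rewrite (minn_idPl ltpc) overlay_upd /overlay ltnNge leq_addr addKn.
Qed.

Definition uses_below (n : nat) (i : instr) : bool :=
  match i with Inc r => r < n | DecJz r _ => r < n end.

Lemma uses_below_ex p : exists n, all (uses_below n) p.
Proof.
elim: p => [|i p [n hn]]; first by exists 0.
exists (maxn n (match i with Inc r => r | DecJz r _ => r end).+1) => /=.
apply/andP; split; first by case: i => /= *; lia.
by apply: sub_all hn => -[] /= *; lia.
Qed.

Lemma rm_run_unused p n k pc g x : all (uses_below n) p -> n <= x ->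
  (rm_run p k (pc, g)).2 x = g x.
Proof.
move=> un nx; elim: k => //= k; case: (rm_run p k (pc, g)) => {}pc g' /= <-.
case: ltnP => // ltpc; have := all_nthP (Inc 0) un pc ltpc.
by case: (nth _ _ _) => [r|r l] /= rn; [|case: ifP => // _];
  rewrite /= /rm_upd; case: eqP => //; lia.
Qed.

(** The argument is computed into [d], which is register 0 of the relocated machine; the scratch
    registers above are 0, so this is its initial state. Its output appears in [d] again, and the
    finitely many other registers it may have touched are cleared. *)
Lemma computable_call h n f :
  total_recursive h -> computable n f -> computable n (fun s => h (f s)).
Proof.
move=> [q hq] [df cf]; split=> [s s' /df-> //|d nd d1].
have [p hp] := cf d nd d1; have [M uM] := uses_below_ex q.
have [r hr] := runs_clear_range d.+1 M (leqW d1).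
exists (seq_prog p (seq_prog (relocate d q) r)) => s cs.
have [z hs] := cs.
apply: runs_seq (hp _ cs) _.
have [k [hk ek]] := hq (f s).
have run := rm_run_relocate q d s k 0 (rm_init (f s)).2.
have unused x := rm_run_unused q M k 0 (rm_init (f s)).2 x uM.
rewrite -[(0, _)]/(rm_init (f s)) in run unused.
move: run unused hk ek; case: (rm_run q k (rm_init (f s))) => pc g /=.
rewrite min0n => run unused hpc g0; rewrite (minn_idPr hpc) in run.
apply: (@runs_seq _ _ _ (overlay d s g)).
  split.
    rewrite size_map all_map (@eq_all _ _ predT) ?all_predT // => -[|? ?] //=.
    by rewrite geq_minr.
  exists k; rewrite size_map -run; congr rm_run; congr pair.
  apply: funext => x; rewrite /rm_upd /overlay.
  case: eqP => [->|?]; first by rewrite ltnn subnn.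
  case: ltnP => // dx; rewrite hs //; case: eqP => //; lia.
rewrite [X in runs _ _ X](_ : _ =
  (fun x => if d.+1 <= x < d.+1 + M then 0 else overlay d s g x)); last first.
  apply: funext => x; rewrite /rm_upd /overlay.
  case: eqP => [->|?]; first by rewrite !ltnn subnn g0.
  case: (ltnP x d) => xd; first by case: ifP => //; lia.
  rewrite hs //; case: ifP => // ?; rewrite unused; last lia.
  by case: eqP => //; lia.
by apply: hr; rewrite /overlay d1.
Qed.

(** Register 0 holds the input and register 1 must stay the zero register, so the result is computed
    in register 2 and moved to 0. *)
Lemma total_recursive_computable h :
  computable 2 (fun s => h (s 0)) -> total_recursive h.
Proof.
move=> [_ /(_ 2 isT isT)[p hp]].
exists (seq_prog p (seq_prog (loop_prog 0 [::]) (loop_prog 2 [:: Inc 0]))) => n.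
set q := seq_prog _ _.
suff [_ [k hk]] : runs q (rm_init n).2 (rm_upd (fun=> 0) 0 (h n)).
  by exists k; rewrite [rm_init n]surjective_pairing hk.
apply: runs_seq; first by apply: hp; split=> // -[].
apply: runs_seq; first exact: runs_clear.
set s := rm_upd _ 0 0; rewrite [X in runs _ _ X](_ : _ =
  rm_upd (rm_upd s 0 (s 0 + s 2)) 2 0); first exact: runs_move.
by rewrite /s; states.
Qed.

(** * Computability of arithmetic and of the codings *)

Definition computable1 (f : nat -> nat) := forall n e,
  computable n e -> computable n (fun s => f (e s)).
Definition computable2 (f : nat -> nat -> nat) := forall n e1 e2,
  computable n e1 -> computable n e2 -> computable n (fun s => f (e1 s) (e2 s)).

Lemma computable1P f :
  (forall d x, x < d -> x != 1 -> computable d (fun s => f (s x))) ->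
  computable1 f.
Proof.
move=> hf n e ce; apply: (computable_let n e (fun v _ => f v)) => // d nd d1.
by apply: hf; lia.
Qed.

Lemma computable2P f :
  (forall d x y, x < d -> y < d -> x != 1 -> y != 1 ->
     computable d (fun s => f (s x) (s y))) ->
  computable2 f.
Proof.
move=> hf n e1 e2 c1 c2.
apply: (computable_let n e1 (fun v s => f v (e2 s))) => //.
  by move=> v s s' h; rewrite (c2.1 _ _ h).
move=> d nd d1; apply: (computable_let d.+1 e2 (fun v s => f (s d) v)).
- by apply: computableW c2; lia.
- by move=> v s s' h; rewrite h.
- by move=> d' dd' d1'; apply: hf; lia.
Qed.

Lemma eq_computable n f g : f =1 g -> computable n f -> computable n g.
Proof. by move=> /funext->. Qed.

Lemma computable_const n c : computable n (fun=> c).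
Proof. by elim: c => [|c IH]; [apply: computable0|apply: computableS]. Qed.

Ltac comp_var := apply: computable_var; lia.

Lemma computable_add : computable2 addn.
Proof.
apply: computable2P => d x y xd yd x1 y1.
apply: (@eq_computable _ (fun s => iteri (s y) (fun _ a => a.+1) (s x))).
  by move=> s; elim: (s y) => /= [|k ->]; lia.
apply: (computable_iteri _ _ _ (fun _ a _ => a.+1)); try comp_var; first by [].
by move=> e de e1; apply: computableS; comp_var.
Qed.

Lemma computable_sub : computable2 subn.
Proof.
apply: computable2P => d x y xd yd x1 y1.
apply: (@eq_computable _ (fun s => iteri (s y) (fun _ a => a.-1) (s x))).
  by move=> s; elim: (s y) => /= [|k ->]; lia.
apply: (computable_iteri _ _ _ (fun _ a _ => a.-1)); try comp_var; first by [].
by move=> e de e1; apply: computable_pred; comp_var.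
Qed.

Lemma computable_mul : computable2 muln.
Proof.
apply: computable2P => d x y xd yd x1 y1.
apply: (@eq_computable _ (fun s => iteri (s y) (fun _ a => a + s x) 0)).
  by move=> s; elim: (s y) => [|k /= ->]; rewrite ?muln0 // mulnS addnC.
apply: (computable_iteri _ _ _ (fun _ a s => a + s x)); first by comp_var.
- exact: computable0.
- by move=> k a s s' h; rewrite h.
by move=> e de e1; apply: computable_add; comp_var.
Qed.

Lemma computable_exp : computable2 expn.
Proof.
apply: computable2P => d x y xd yd x1 y1.
apply: (@eq_computable _ (fun s => iteri (s y) (fun _ a => s x * a) 1)).
  by move=> s; elim: (s y) => [|k /= ->]; rewrite ?expn0 // expnS.
apply: (computable_iteri _ _ _ (fun _ a s => s x * a)); first by comp_var.
- exact: computable_const.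
- by move=> k a s s' h; rewrite h.
by move=> e de e1; apply: computable_mul; comp_var.
Qed.

Lemma computable_sum n m (F : nat -> (nat -> nat) -> nat) :
  computable n m -> (forall k, depends n (F k)) ->
  (forall d, n <= d -> 1 < d -> computable d.+1 (fun s => F (s d) s)) ->
  computable n (fun s => \sum_(k < m s) F k s).
Proof.
move=> cm dF cF.
apply: (@eq_computable _ (fun s => iteri (m s) (fun k a => a + F k s) 0)).
  by move=> s; elim: (m s) => [|k /= ->]; rewrite ?big_ord0 // big_ord_recr.
apply: (computable_iteri _ _ _ (fun k a s => a + F k s)) => //.
- exact: computable0.
- by move=> k a s s' h; rewrite (dF k _ _ h).
move=> d nd d1; apply: computable_add; first by comp_var.
by apply: computableW (cF d nd d1).
Qed.

Ltac comp_arith := repeat first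
  [ comp_var | apply: computable_const
  | apply: computable_add | apply: computable_sub | apply: computable_mul
  | apply: computable_exp | apply: computableS | apply: computable_pred ].

(** With truncated subtraction this gives comparisons and negation by arithmetic alone. *)
Lemma exp0nE n : 0 ^ n = (n == 0).
Proof. by case: n => // n; rewrite exp0n. Qed.

(** For nonzero [d] the sum counts the positive multiples of [d] up to [m]. For [d = 0] the sum is
    [m], and the first factor turns it into the conventional value 0. *)
Lemma divn_sum m d : m %/ d = 0 ^ (0 ^ d) * \sum_(i < m) 0 ^ (i.+1 * d - m).
Proof.
case: d => [|d]; first by rewrite divn0.
rewrite !exp0nE mul1n.
transitivity (\sum_(i < m) (i < m %/ d.+1)).
  have := leq_div m d.+1; move: (m %/ d.+1) => q qm.
  rewrite -(subnKC qm) big_split_ord /=.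
  rewrite [X in X + _](eq_bigr (fun=> 1)) => [|i _]; last by rewrite ltn_ord.
  rewrite sum1_card card_ord big1 ?addn0 // => i _.
  by rewrite ltnNge leq_addr.
by apply: eq_bigr => i _; rewrite leq_divRL // exp0nE subn_eq0.
Qed.

Lemma computable_div : computable2 divn.
Proof.
apply: computable2P => d x y xd yd x1 y1.
apply: eq_computable (fun s => esym (divn_sum (s x) (s y))) _.
apply: computable_mul; first by comp_arith.
apply: (computable_sum _ _ (fun i s => 0 ^ (i.+1 * s y - s x))).
- by comp_arith.
- by move=> k s s' h; rewrite !h.
by move=> e de e1; comp_arith.
Qed.

Lemma computable_mod : computable2 modn.
Proof.
apply: computable2P => d x y xd yd x1 y1.
apply: (@eq_computable _ (fun s => s x - s x %/ s y * s y)).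
  by move=> s; rewrite {1}(divn_eq (s x) (s y)) addKn.
by comp_arith; apply: computable_div; comp_arith.
Qed.

Lemma computable_nfst : computable1 nfst.
Proof.
apply: computable1P => d x xd x1.
apply: (@eq_computable _ (fun s => \sum_(k < s x) 0 ^ ((s x).+1 %% 2 ^ k.+1))).
  move=> s; rewrite /nfst logn_count_dvd // big_add1 big_mkord.
  by apply: eq_bigr => i _; rewrite exp0nE.
apply: (computable_sum _ _ (fun k s => 0 ^ ((s x).+1 %% 2 ^ k.+1))).
- by comp_arith.
- by move=> k s s' h; rewrite h.
by move=> e de e1; comp_arith; apply: computable_mod; comp_arith.
Qed.

Lemma computable_nsnd : computable1 nsnd.
Proof.
apply: computable1P => d x xd x1.
apply: (@eq_computable _ (fun s => (s x).+1 %/ 2 ^ (nfst (s x)).+1)).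
  by move=> s; rewrite /nsnd -divn2 -divnMA -expnSr.
by apply: computable_div; comp_arith; apply: computable_nfst; comp_arith.
Qed.

Lemma computable_npair : computable2 npair.
Proof.
apply: computable2P => d x y xd yd x1 y1.
apply: (@eq_computable _ (fun s => (2 ^ s x * (s y + s y).+1).-1)).
  by move=> s; rewrite /npair addnn.
by comp_arith.
Qed.

(** Turns the recursion along the coded sequence into an iteration, the form that [computable_iteri]
    handles. *)
Lemma seq_compE c i : seq_comp c i = nfst (iteri i (fun=> nsnd) c).
Proof.
elim: i c => //= i IH c; rewrite IH; congr nfst.
by elim: {IH} i => //= i ->.
Qed.

Lemma computable_seq_comp : computable2 seq_comp.
Proof.
apply: computable2P => d x y xd yd x1 y1.
apply: eq_computable (fun s => esym (seq_compE (s x) (s y))) _.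
apply: computable_nfst.
apply: (computable_iteri _ _ _ (fun _ a _ => nsnd a)); try comp_var; first by [].
by move=> e de e1; apply: computable_nsnd; comp_var.
Qed.

(** * The search *)

(* The positive part of [int_of_nat z]. *)
Definition pos_numerator (z : nat) : nat := (1 - z %% 2) * (z %/ 2).

(* The integer part of w * max(0, [rat_of_nat m]). *)
Definition scaled_pos_part (w m : nat) : nat :=
  w * pos_numerator (nfst m) %/ (nsnd m).+1.

Definition off_diag_mass (h : nat -> nat) (N w : nat) : nat :=
  \sum_(j < N) (val j != w %% N) *
    scaled_pos_part w (seq_comp (h (npair N w)) (2 * (j * N + j))).

(* off_diag_mass / w > 1 - 2 / N, without division or subtraction; it fails for
   w = 0. *)
Definition small_entry_test (h : nat -> nat) (N w : nat) : bool :=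
  w * N < N * off_diag_mass h N w + 2 * w.

(* Code of the matrix unit E_ii: 7 = npair 3 0 and 2 x = npair 0 x, so this is
   the code of the sequence with only nonzero term 3, the code of the rational 1,
   at the position of the real part of the entry (i, i). *)
Definition unit_code (N i : nat) : nat := 7 * 2 ^ (2 * (i * N + i)).

(** The value 0 means that nothing has been found yet: it is never a unit code, and it decodes to
    the zero matrix. *)
Definition small_entry_search (h : nat -> nat) (N t : nat) : nat :=
  iteri t (fun w a =>
    if a == 0 then small_entry_test h N w * unit_code N (w %% N) else a) 0.

Ltac comp_code := comp_arith; repeat
  first [ apply: computable_npair | apply: computable_seq_comp
        | apply: computable_nfst | apply: computable_nsnd
        | apply: computable_div | apply: computable_mod
        | apply: computable_call; first assumption | progress comp_arith ].

Section SearchComputable.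
Variable h : nat -> nat.
Hypothesis h_rec : total_recursive h.

Lemma computable_off_diag_mass : computable2 (off_diag_mass h).
Proof.
apply: computable2P => d x y xd yd x1 y1.
pose c s := h (npair (s x) (s y)).
(* The nested powers are the truth value of [j != s y %% s x], the inner sum being the distance of
   the two numbers. *)
pose F j s := 0 ^ (0 ^ ((j - s y %% s x) + (s y %% s x - j))) *
  scaled_pos_part (s y) (seq_comp (c s) (2 * (j * s x + j))).
apply: (@eq_computable _ (fun s => \sum_(j < s x) F j s)).
  move=> s; apply: eq_bigr => j _; congr muln; rewrite !exp0nE addn_eq0 !subn_eq0.
  by rewrite -eqn_leq eqb0.
apply: computable_sum; first by comp_arith.
- by move=> k s s' e; rewrite /F /c !e.
by move=> e de e1; rewrite /F /c /scaled_pos_part /pos_numerator; comp_code.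
Qed.

Lemma total_recursive_search :
  total_recursive (fun z => small_entry_search h (nfst z) (nsnd z)).
Proof.
apply: total_recursive_computable.
(* Arithmetic form of the conditional: the factor [0 ^ a] drops the second term once [a] is nonzero,
   and [0 ^ (x.+1 - y)] is the truth value of [x < y]. *)
pose F w a s := a + 0 ^ a *
  (0 ^ ((w * nfst (s 0)).+1 -
        (nfst (s 0) * off_diag_mass h (nfst (s 0)) w + 2 * w)) *
   unit_code (nfst (s 0)) (w %% nfst (s 0))).
apply: (@eq_computable _
  (fun s => iteri (nsnd (s 0)) (fun w a => F w a s) 0)).
  move=> s; rewrite /small_entry_search; elim: (nsnd (s 0)) => //= k ->.
  rewrite /F !exp0nE subn_eq0 -/(small_entry_test _ _ _).
  by case: eqP => [->|_]; rewrite ?mul1n ?mul0n ?addn0.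
apply: computable_iteri; [by comp_code|exact: computable0| |].
- by move=> k a s s' e; rewrite /F !e.
move=> d d2 _; rewrite /F /unit_code; comp_code.
by apply: computable_off_diag_mass; comp_code.
Qed.

End SearchComputable.

(** * Decoded matrices and the Loewner order *)

Lemma npair_succ a b : (npair a b).+1 = 2 ^ a * b.*2.+1.
Proof. by rewrite /npair prednK // muln_gt0 expn_gt0. Qed.

Lemma npairK1 a b : nfst (npair a b) = a.
Proof.
rewrite /nfst npair_succ lognM ?expn_gt0 // pfactorK //.
by rewrite logn_coprime ?addn0 // coprime2n /= odd_double.
Qed.

Lemma npairK2 a b : nsnd (npair a b) = b.
Proof.
by rewrite /nsnd npairK1 npair_succ mulKn ?expn_gt0 //= uphalf_double.
Qed.

Lemma seq_comp_npair0 a b : seq_comp (npair a b) 0 = a.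
Proof. exact: npairK1. Qed.

Lemma seq_comp_npairS a b i : seq_comp (npair a b) i.+1 = seq_comp b i.
Proof. by rewrite -[LHS]/(seq_comp (nsnd (npair a b)) i) npairK2. Qed.

Lemma seq_comp0 i : seq_comp 0 i = 0.
Proof.
have e : 0 = npair 0 0 by [].
by elim: i => [|i IH]; rewrite [in LHS]e ?seq_comp_npair0 ?seq_comp_npairS.
Qed.

Lemma seq_comp_unit_code t i : seq_comp (7 * 2 ^ t) i = 3 * (i == t).
Proof.
elim: t i => [|t IH] i.
  have -> : 7 * 2 ^ 0 = npair 3 0 by [].
  by case: i => [|i]; rewrite ?seq_comp_npair0 ?seq_comp_npairS ?seq_comp0.
have -> : 7 * 2 ^ t.+1 = npair 0 (7 * 2 ^ t).
  by rewrite /npair mul1n /= -muln2 expnSr mulnA.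
by case: i => [|i]; rewrite ?seq_comp_npair0 ?seq_comp_npairS ?IH.
Qed.

Lemma rat_of_nat0 : rat_of_nat 0 = 0%R.
Proof.
by rewrite /rat_of_nat -[0 in LHS]/(npair 0 0) npairK1 /int_of_nat /= mul0r.
Qed.

Lemma rat_of_nat3 : rat_of_nat 3 = 1%R.
Proof.
by rewrite /rat_of_nat -[3]/(npair 2 0) npairK1 npairK2 /int_of_nat /= divr1.
Qed.

Local Open Scope ring_scope.
Local Open Scope complex_scope.

Section Matrices.
Variable R : realType.

Lemma decode_mx0 N : decode_mx R N 0 = 0.
Proof. by apply/matrixP => i j; rewrite !mxE !seq_comp0 rat_of_nat0 raddf0. Qed.

Lemma decode_unit_code N (i : 'I_N) :
  decode_mx R N (unit_code N i) = delta_mx i i.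
Proof.
have N0 : (0 < N)%N := leq_ltn_trans (leq0n _) (ltn_ord i).
apply/matrixP => a b; rewrite !mxE /unit_code !seq_comp_unit_code.
(* Imaginary parts have odd positions, the nonzero term an even one. *)
have -> : ((2 * (a * N + b)).+1 == 2 * (i * N + i) = false)%N by apply/eqP; lia.
rewrite muln0 rat_of_nat0 raddf0.
have -> : ((2 * (a * N + b) == 2 * (i * N + i)) = (a == i) && (b == i))%N.
  rewrite eqn_pmul2l //; apply/eqP/andP => [e|[/eqP-> /eqP->] //].
  have ab : a = i.
    apply: val_inj; have := congr1 (divn^~ N) e.
    by rewrite !divnMDl // !divn_small // !addn0.
  by move: e; rewrite ab => /addnI/val_inj ->.
by case: (_ && _); rewrite ?muln1 ?muln0 ?rat_of_nat3 ?rat_of_nat0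
  ?raddf0 ?rmorph1.
Qed.

(** Rounding down loses at most 1. The upper bound serves the soundness of the test and the lower
    bound its completeness. *)
Lemma scaled_pos_partP (w m : nat) :
  let q : R := ratr (rat_of_nat m) in
  (scaled_pos_part w m)%:R <= w%:R * Num.max 0 q /\
  w%:R * q - 1 <= (scaled_pos_part w m)%:R.
Proof.
move=> q; rewrite /scaled_pos_part.
set d := (nsnd m).+1; set p := pos_numerator _.
have d0 : (0 : R) < d%:R by rewrite ltr0n.
have qE : Num.max 0 q = p%:R / d%:R.
  rewrite /q /rat_of_nat fmorph_div /= ratr_int ratr_nat /int_of_nat -/d /p.
  rewrite /pos_numerator modn2 divn2; case: (odd _).
    rewrite mul0n mul0r; apply/max_l; rewrite mulrNz mulNr oppr_le0.
    by rewrite divr_ge0 // ler0n.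
  by rewrite mul1n; apply/max_r; rewrite divr_ge0 // ler0n.
have q_le : q <= p%:R / d%:R by rewrite -qE le_max lexx orbT.
have dv := divn_eq (w * p) d; have ml := ltn_pmod (w * p) (ltn0Sn _ : 0 < d)%N.
rewrite qE mulrA -natrM; split.
  by rewrite ler_pdivlMr // -natrM ler_nat leq_divM.
apply: (@le_trans _ _ ((w * p)%:R / d%:R - 1)).
  by rewrite lerD2r natrM -mulrA ler_wpM2l.
rewrite lerBlDr ler_pdivrMr // natr1 -natrM ler_nat.
by rewrite {1}dv mulSn addnC leq_add2r ltnW.
Qed.

Lemma psd0 N : psd (0 : 'M[R[i]]_N).
Proof.
split=> [|v]; last by rewrite mulmx0 mul0mx mxE.
by apply/matrixP => i j; rewrite !mxE conjc0.
Qed.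

Lemma psd_diag N (A : 'M[R[i]]_N) i : psd A -> 0 <= complex.Re (A i i).
Proof.
move=> [_ /(_ (delta_mx i 0))].
have -> : map_mx conjc (delta_mx i 0) = delta_mx i 0 :> 'cV[R[i]]_N.
  by apply/matrixP => a b; rewrite !mxE conjc_nat.
by rewrite trmx_delta -rowE -colE !mxE lecE => /andP[].
Qed.

Lemma psd_delta N (i : 'I_N) : psd (delta_mx i i : 'M[R[i]]_N).
Proof.
split=> [|v]; first by apply/matrixP => a b; rewrite !mxE conjc_nat andbC.
rewrite -(mul_delta_mx (0 : 'I_1)) mulmxA -colE -mulmxA -rowE mxE big_ord1.
by rewrite !mxE mulrC mulcJ_ge0.
Qed.

Lemma semi_density_delta N (i : 'I_N) :
  semi_density (delta_mx i i : 'M[R[i]]_N).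
Proof.
have pd := psd_delta _ i; split; first by case: pd.
split=> //; rewrite /mxtrace (bigD1 i) //= mxE !eqxx big1 ?addr0 // => j ji.
by rewrite mxE (negbTE ji).
Qed.

Lemma semi_density0 N : semi_density (0 : 'M[R[i]]_N).
Proof. by have p0 := psd0 N; split; [case: p0|rewrite mxtrace0 ler01]. Qed.

Lemma ReB (x y : R[i]) : complex.Re (x - y) = complex.Re x - complex.Re y.
Proof. by case: x y => ? ? []. Qed.

Lemma Re_sum (I : Type) (r : seq I) (P : pred I) (F : I -> R[i]) :
  complex.Re (\sum_(i <- r | P i) F i) = \sum_(i <- r | P i) complex.Re (F i).
Proof. by elim/big_rec2: _ => // i x y _ <-; case: (F i) y => ? ? []. Qed.

End Matrices.

(** * The matrix found by the search *)

Section Search.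
Variable h : nat -> nat.

Lemma unit_code_neq0 N i : (unit_code N i != 0)%N.
Proof. by rewrite /unit_code muln_eq0 expn_eq0. Qed.

Lemma searchS N t : small_entry_search h N t.+1 =
  if small_entry_search h N t == 0%N
  then (small_entry_test h N t * unit_code N (t %% N))%N
  else small_entry_search h N t.
Proof. by []. Qed.

Lemma search_stable N t u : (t <= u)%N -> small_entry_search h N t != 0%N ->
  small_entry_search h N u = small_entry_search h N t.
Proof.
move=> tu t0; elim: u tu => [|u IH]; first by rewrite leqn0 => /eqP->.
rewrite leq_eqVlt => /orP[/eqP-> //|tu].
by rewrite searchS (IH tu) (negbTE t0).
Qed.

Lemma search_value N t : small_entry_search h N t != 0%N ->
  exists2 w, small_entry_test h N w &
    small_entry_search h N t = unit_code N (w %% N).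
Proof.
elim: t => // t IH; rewrite searchS; case: ifP => [_|/negbT n0 _]; last exact: IH.
by case: (boolP (small_entry_test h N t)) => // ht _; exists t; rewrite ?mul1n.
Qed.

Lemma search_found N w : small_entry_test h N w ->
  small_entry_search h N w.+1 != 0%N.
Proof.
move=> tw; rewrite searchS; case: ifP => [_|/negbT //].
by rewrite tw mul1n unit_code_neq0.
Qed.

Variable R : realType.

(** The choice of a successful stage is classical; by [search_stable] it does not affect the
    value. *)
Definition search_limit (N : nat) : 'M[R[i]]_N :=
  if pselect (exists t, small_entry_search h N t != 0%N) is left e
  then decode_mx R N (small_entry_search h N (projT1 (cid e))) else 0.

Lemma search_limitP N : exists t0, forall t, (t0 <= t)%N ->
  decode_mx R N (small_entry_search h N t) = search_limit N.
Proof.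
rewrite /search_limit; case: pselect => [e|ne].
  by case: cid => t0 /= ht0; exists t0 => t tt; rewrite (search_stable _ _ _ tt).
exists 0%N => t _; case: (eqVneq (small_entry_search h N t) 0%N) => [->|nz].
  exact: decode_mx0.
by case: ne; exists t.
Qed.

Lemma decode_search N t : (0 < N)%N ->
  small_entry_search h N t = 0%N \/
  exists2 i : 'I_N, decode_mx R N (small_entry_search h N t) = delta_mx i i &
    exists2 w, small_entry_test h N w & val i = (w %% N)%N.
Proof.
move=> N0; case: (eqVneq (small_entry_search h N t) 0%N) => [|]; first by left.
move=> /search_value[w tw ->]; right.
exists (Ordinal (ltn_pmod w N0)); last by exists w.
by rewrite -decode_unit_code.
Qed.

(** The approximations are 0 until the search succeeds and a fixed $E_{ii}$ from then on, so they
    increase and are eventually constant. *)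
Lemma lsc_search_limit : total_recursive h -> lsc_semi_density search_limit.
Proof.
move=> hrec; split=> [N N0|].
  have [t0 /(_ t0 (leqnn t0)) <-] := search_limitP N.
  case: (decode_search N t0 N0) => [->|[i -> _]]; rewrite ?decode_mx0.
    exact: semi_density0.
  exact: semi_density_delta.
exists (fun z => small_entry_search h (nfst z) (nsnd z)).
split; first exact: total_recursive_search.
move=> N N0; have hE k :
    small_entry_search h (nfst (npair N k)) (nsnd (npair N k))
    = small_entry_search h N k by rewrite npairK1 npairK2.
split=> [k|]; first rewrite hE.
  case: (decode_search N k N0) => [->|[i -> _]]; rewrite ?decode_mx0.
    by case: (psd0 R N).
  by case: (psd_delta R _ i).
split=> [k|i j].
  rewrite !hE /loewner_le.
  case: (eqVneq (small_entry_search h N k) 0%N) => [->|nz]; last first.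
    by rewrite (search_stable _ _ _ (leqnSn k) nz) subrr; apply: psd0.
  rewrite decode_mx0 subr0.
  case: (decode_search N k.+1 N0) => [->|[i -> _]]; rewrite ?decode_mx0.
    exact: psd0.
  exact: psd_delta.
have [t0 ht0] := search_limitP N.
by split; apply: cvg_near_cst; exists t0 => // t /= tt; rewrite hE ht0.
Qed.

(** * Correctness of the search test *)

Definition diag_entry (N w : nat) (j : 'I_N) : R :=
  ratr (rat_of_nat (seq_comp (h (npair N w)) (2 * (j * N + j)))).

Lemma off_diag_massE N w : (off_diag_mass h N w)%:R =
  \sum_(j < N | val j != (w %% N)%N)
   (scaled_pos_part w (seq_comp (h (npair N w)) (2 * (j * N + j))))%:R :> R.
Proof.
rewrite /off_diag_mass natr_sum [RHS]big_mkcond; apply: eq_bigr => j _.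
by case: ifP; rewrite ?mul1n ?mul0n.
Qed.

(** The entries of [m] other than [m i] add up to at most [1 - m i], and each bounds the positive
    part of its approximation; the test thus gives $w(1 - 2/N) < w(1 - m_i)$. *)
Lemma test_sound N w (m : 'I_N -> R) (i : 'I_N) :
  (forall j, 0 <= m j) -> \sum_j m j <= 1 ->
  (forall j, diag_entry N w j <= m j) ->
  small_entry_test h N w -> val i = (w %% N)%N -> m i < 2 / N%:R.
Proof.
move=> m0 m1 dm tw iw.
have N0 : (0 : R) < N%:R by rewrite ltr0n (leq_ltn_trans _ (ltn_ord i)).
have ub : (off_diag_mass h N w)%:R <= w%:R * (1 - m i).
  rewrite off_diag_massE.
  apply: (@le_trans _ _ (\sum_(j < N | j != i) w%:R * m j)).
    rewrite -iw; apply: ler_sum => j _.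
    have [+ _] := scaled_pos_partP R w
      (seq_comp (h (npair N w)) (2 * (j * N + j))).
    move=> /le_trans; apply.
    by rewrite ler_wpM2l // ge_max m0 dm.
  rewrite -mulr_sumr ler_wpM2l // lerBrDl.
  by move: m1; rewrite (bigD1 i).
move: tw; rewrite /small_entry_test -(ltr_nat R) natrD !natrM => tw.
rewrite ltr_pdivlMr //.
have lt1 : w%:R * N%:R < N%:R * (w%:R * (1 - m i)) + 2 * w%:R :> R.
  by apply: lt_le_trans tw _; rewrite lerD2r ler_wpM2l // ltW.
have w0 : (0 : R) <= w%:R by [].
have {}w0 : (0 : R) < w%:R.
  by rewrite lt_neqAle w0 andbT; apply/eqP => e; move: lt1; rewrite -e; lra.
by rewrite -(ltr_pM2l w0); lra.
Qed.

(** Some [m i] is at most the average $1/N$, so the other entries add up to at least $1 - 1/N$. The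
    surplus $1/N$ over the threshold pays for the approximation and rounding errors at a late stage
    [w] congruent to [i]. *)
Lemma test_complete N (m : 'I_N -> R) : \sum_j m j = 1 ->
  (forall j, ((fun k => diag_entry N k j) @ \oo --> m j)%classic) ->
  exists w, small_entry_test h N w.
Proof.
move=> m1 cm.
have N0 : (0 < N)%N.
  by case: N m m1 {cm} => // m; rewrite big_ord0 => /eqP; rewrite eq_sym oner_eq0.
have N0R : (0 : R) < N%:R by rewrite ltr0n.
have [i mi] : exists i, m i <= N%:R^-1.
  apply: contrapT => /forallNP hm.
  suff : \sum_(j < N) N%:R^-1 < \sum_j m j.
    by rewrite m1 sumr_const -[ltLHS]mulr_natl card_ord divff ?ltxx // gt_eqF.
  apply: ltr_sum => [|j _]; last by rewrite ltNge; apply/negP/hm.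
  by apply/hasP; exists (Ordinal N0); rewrite // mem_index_enum.
(* At most [N] entries, each too low by at most [e], cost $1/(2N)$, half of the surplus. *)
pose e : R := (2 * N%:R ^+ 2)^-1.
have e0 : 0 < e by rewrite invr_gt0 mulr_gt0 ?exprn_gt0.
have [K _ hK] :
    (\forall k \near \oo, forall j, m j - e <= diag_entry N k j)%classic.
  by apply: filter_forall => j; apply: (cvgr_ge (m j) (cm j)); rewrite gtrBl.
(* Adding a multiple of [N] keeps the residue [i] and brings [w] above both [K] and $2N^2$; beyond
   the latter, the rounding loss of at most [N], divided by [w], is below the other half of the
   surplus. *)
pose w := (i + N * (K + 2 * N ^ 2).+1)%N.
have wK : (K <= w)%N by rewrite /w; nia.
have wN : (2 * N ^ 2 < w)%N by rewrite /w; nia.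
have wi : (w %% N)%N = i by rewrite /w mulnC addnC modnMDl modn_small.
exists w; rewrite /small_entry_test -(ltr_nat R) natrD !natrM.
have lb : w%:R * (1 - m i) - N%:R * (w%:R * e + 1) <= (off_diag_mass h N w)%:R.
  rewrite off_diag_massE wi.
  have -> : 1 - m i = \sum_(j < N | j != i) m j 
    by rewrite -m1 (bigD1 i) //= addrAC subrr add0r.
  apply: (@le_trans _ _ (\sum_(j < N | j != i) (w%:R * m j - (w%:R * e + 1)))).
    rewrite sumrB -mulr_sumr lerD2l lerN2 sumr_const -[leLHS]mulr_natl.
    apply: ler_wpM2r; first by rewrite addr_ge0 // mulr_ge0 // ltW.
    by rewrite ler_nat -[leqRHS]card_ord max_card.
  apply: ler_sum => j _.
  have [_] := scaled_pos_partP R w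
    (seq_comp (h (npair N w)) (2 * (j * N + j))).
  apply: le_trans; rewrite opprD addrA -mulrBr lerD2r ler_wpM2l //.
  exact: hK.
have Ne : N%:R ^+ 2 * e = 2^-1 :> R.
  by rewrite /e invfM mulrCA divff ?mulr1 // expf_neq0 // gt_eqF.
have Nm : N%:R * m i <= 1 by rewrite mulrC -ler_pdivlMr // mul1r.
move: wN; rewrite -(ltr_nat R) natrM natrX => wN.
have w0 : (0 : R) <= w%:R by [].
have := ler_wpM2l (ltW N0R) lb; nra.
Qed.

End Search.

Theorem mainTheorem14 (R : realType) (mu : forall N : nat, 'M[R[i]]_N) :
  quantum_universal mu ->
  exists N0 : nat, forall N : nat, (0 < N)%N -> (N0 <= N)%N -> \tr (mu N) < 1.
Proof.
move=> [[mu_sd [h [hrec mu_lim]]] univ].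
have [c [c0 hc]] := univ _ (lsc_search_limit h R hrec).
(* The bounds [c <= m i] and [m i < 2 / N] will give [N < 2 / c], which is below this threshold. *)
exists (Num.truncn (2 / c)).+1 => N N0 leN.
have [_ [mu_psd mu_tr]] := mu_sd N N0.
have [_ [mu_mono mu_cvg]] := mu_lim N N0.
rewrite lt_neqAle mu_tr andbT; apply/eqP => tr1.
pose m j := complex.Re (mu N j j).
have m1 : \sum_j m j = 1 by rewrite -Re_sum -/(\tr (mu N)) tr1.
have cvg_m j : ((fun k => diag_entry h R N k j) @ \oo --> m j)%classic.
  rewrite (_ : (fun k => diag_entry h R N k j) =
    (fun k => complex.Re (decode_mx R N (h (npair N k)) j j))).
    by have [] := mu_cvg j j.
  by apply: funext => k; rewrite mxE.
have le_m k j : diag_entry h R N k j <= m j.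
  (* The diagonal of a Loewner-increasing sequence is nondecreasing, hence stays below its limit. *)
  rewrite -(cvg_lim _ (cvg_m j)) //; apply: nondecreasing_cvgn_le.
    apply/nondecreasing_seqP => n; have := psd_diag _ _ _ j (mu_mono n).
    by rewrite !mxE /= subr_ge0.
  by apply: cvgP (cvg_m j).
have [w tw] := test_complete _ _ _ _ m1 cvg_m.
have [t0 ht0] := search_limitP h R N.
(* This stage is late enough both for the limit to be reached and for the search to have
   succeeded. *)
have := ht0 _ (leq_maxl t0 w.+1).
have nz : small_entry_search h N (maxn t0 w.+1) != 0%N.
  rewrite (search_stable _ _ _ _ (leq_maxr t0 w.+1)) ?search_found //.
(* The search may have stopped at some [w'] before [w], so soundness is applied to [w']. *)
case: (decode_search h R N (maxn t0 w.+1) N0) => [|[i -> [w' tw' iw']] sE].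
  by move=> z; rewrite z in nz.
have mi : m i < 2 / N%:R.
  by apply: test_sound tw' iw' => // [j|]; [apply: psd_diag|rewrite m1].
have := psd_diag _ _ _ i (hc N N0); rewrite -sE !mxE !eqxx.
rewrite mulr1 ReB subr_ge0 => /le_lt_trans/(_ mi); rewrite ltr_pdivlMr ?ltr0n //.
rewrite mulrC -ltr_pdivlMr // => /lt_trans/(_ (truncnS_gt _)).
by rewrite ltr_nat ltnNge leN.
Qed.
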